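(* For each integer $q\ge1$ (and each sample size $n\ge 1$), the distribution of $D_q(F_n,F)$ is the same for all continuous $F\in\mathcal{F}$. That is, if $F,G\in\mathcal{F}$ are continuous on $\mathbb{R}$, $X_1,\ldots,X_n$ are i.i.d. real random variables with distribution function $F$ on some probability space with empirical distribution function $F_n(x)=\frac1n\sum_{i=1}^n\mathbf{1}_{(-\infty,x]}(X_i)$, and $Y_1,\ldots,Y_n$ are i.i.d. real random variables with distribution function $G$ on some (possibly different) probability space with empirical distribution function $G_n(x)=\frac1n\sum_{i=1}^n\mathbf{1}_{(-\infty,x]}(Y_i)$, then $D_q(F_n,F)$ and $D_q(G_n,G)$ have the same distribution.
   Context: $\mathcal{F}$ denotes the set of distribution functions on $\mathbb{R}$: functions $F:\mathbb{R}\to\mathbb{R}$ that are nondecreasing, right-continuous, and satisfy $F(-\infty):=\lim_{x\to-\infty}F(x)=0$ and $F(\infty):=\lim_{x\to\infty}F(x)=1$. For $-\infty\le x\le y\le\infty$ write $F|_x^y = F(y)-F(x)$. For an integer $q\ge1$ let $\mathbb{R}^q_{\le}=\{(v_1,\ldots,v_q)\in\mathbb{R}^q: v_1\le\cdots\le v_q\}$. For $F,G\in\mathcal{F}$ and $\boldsymbol{v}=(v_1,\ldots,v_q)\in\mathbb{R}^q_{\le}$, with the convention $v_0=-\infty$ and $v_{q+1}=\infty$, put $$r_{F,G}(\boldsymbol{v})=\sum_{i=0}^q \min\bigl\{F|_{v_i}^{v_{i+1}},\,G|_{v_i}^{v_{i+1}}\bigr\},\qquad D_q(F,G)=1-\inf_{\boldsymbol{v}\in\mathbb{R}^q_{\le}}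 r_{F,G}(\boldsymbol{v}).$$ $\mathbf{1}_A$ denotes the indicator function of a set $A$. *)

(* Defs.v *)
From HB Require Import structures.
From mathcomp Require Import all_boot all_order all_algebra.
From mathcomp Require Import all_classical all_reals all_analysis.

Set Implicit Arguments.
Unset Strict Implicit.
Unset Printing Implicit Defensive.

Import Order.TTheory GRing.Theory Num.Theory.
Import numFieldNormedType.Exports.

Local Open Scope classical_set_scope.
Local Open Scope ring_scope.

(* The class of distribution functions on the line is the library's
   [cumulativeBounded 0 1]: nondecreasing, right-continuous functions with
   limits 0 at -oo and 1 at +oo. *)
Notation distrib_fun R := (@cumulativeBounded R (0 : R) (1 : R)).

Definition extend_df (R : realType) (F : R -> R) (x : \bar R) : R :=
  match x with
  | r%:E => F r
  | -oo%E => lim (F @ -oo)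
  | +oo%E => lim (F @ +oo)
  end.

Lemma extend_dfNy (R : realType) (F : distrib_fun R) : extend_df F -oo%E = 0.
Proof. by apply: cvg_lim => //; exact: cumulativeNy. Qed.

Lemma extend_dfy (R : realType) (F : distrib_fun R) : extend_df F +oo%E = 1.
Proof. by apply: cvg_lim => //; exact: cumulativey. Qed.

Definition increment (R : realType) (F : R -> R) (x y : \bar R) : R :=
  extend_df F y - extend_df F x.

(* [cutpoint v 0 = -oo], [cutpoint v q.+1 = +oo], and, the entries of the tuple
   [v] being numbered from 0, [cutpoint v i.+1 = v_i] for [i < q]. *)
Definition cutpoint (R : realType) (q : nat) (v : q.-tuple R) (i : nat) : \bar R :=
  nth +oo%E (-oo%E :: rcons [seq x%:E | x <- v] +oo%E) i.

Definition overlap (R : realType) (q : nat) (F G : R -> R) (v : q.-tuple R) : R :=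
  \sum_(i < q.+1)
     Num.min (increment F (cutpoint v i) (cutpoint v i.+1))
             (increment G (cutpoint v i) (cutpoint v i.+1)).

Definition Ddist (R : realType) (q : nat) (F G : R -> R) : R :=
  1 - inf [set overlap F G v | v in [set v : q.-tuple R | sorted <=%R v]].

Definition empirical_df (R : realType) (n : nat) (x : 'I_n -> R) (t : R) : R :=
  n%:R^-1 * \sum_(i < n) \1_`]-oo, t]%classic (x i).

Definition mutually_independent (R : realType) (d : measure_display)
    (T : measurableType d) (P : probability T R) (I : finType)
    (X : I -> {RV P >-> R}) : Prop :=
  forall (J : {set I}) (B : I -> set R), (forall i, measurable (B i)) ->
    P (\bigcap_(i in [set` J]) X i @^-1` B i) =
    (\prod_(i in J) P (X i @^-1` B i))%E.

Definition iid_with_df (R : realType) (d : measure_display)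
    (T : measurableType d) (P : probability T R) (n : nat)
    (X : 'I_n -> {RV P >-> R}) (F : R -> R) : Prop :=
  mutually_independent X /\ forall i x, cdf (X i) x = (F x)%:E.

(* Measurability is part of the notion: without it the two functions would have
   no distribution to compare. *)
Definition same_distribution (R : realType) (d1 d2 : measure_display)
    (T1 : measurableType d1) (T2 : measurableType d2)
    (P : probability T1 R) (Q : probability T2 R)
    (U : T1 -> R) (V : T2 -> R) : Prop :=
  [/\ measurable_fun setT U, measurable_fun setT V &
      forall A : set R, measurable A -> pushforward P U A = pushforward Q V A].

(* Main.v *)
From HB Require Import structures.
Require Import Defs.
From mathcomp Require Import all_boot all_order all_algebra.
From mathcomp Require Import all_classical all_reals all_analysis.
From mathcomp Require Import measurable_realfun.
Import numFieldNormedType.Exports.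
Local Open Scope classical_set_scope.
Local Open Scope ring_scope.
Import Order.TTheory GRing.Theory Num.Theory.

(** The statistic depends on the sample and on the distribution function [F]
only through the transformed sample [F X_1, ..., F X_n], which is an independent
uniform sample whatever the continuous [F].

The overlap of two functions at a tuple of cut points depends only on their
values there ([overlap_map]).  Hence, when the empirical function of the [X_i]
is the composite of that of the [F X_i] with [F], replacing the cut points [v]
by [F v] turns overlaps of the former with [F] into overlaps of the latter with
the uniform distribution function.  This factorization can fail only if some
[X_i] lies in a flat part of [F], beyond its left end, which has probability
zero ([ae_df_strict]).  As [F] takes all values in the open unit interval, and
other levels are approximated by such values, the infima agree
([Ddist_empirical_unif]): almost surely the statistic is a fixed function [h],
independent of [F], of the transformed sample.

It remains to compare laws.  Continuity of [F] makes each [F X_i] uniform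
([law_df_unif]), and independence then determines the joint law on boxes, hence
everywhere ([iid_law_unif]).  For [h] to have a law, and for the statistic
itself to be measurable rather than only almost surely equal to a measurable
function, the infimum over all cut points is reduced to rational ones by
right-continuity ([inf_overlap_rat], [measurable_Ddist]). *)

Set Implicit Arguments.
Unset Strict Implicit.

(** * Overlaps as functions of the values at the cut points *)

Lemma sorted_nseq (T : Type) (r : rel T) (n : nat) (x : T) :
  r x x -> sorted r (nseq n x).
Proof. by move=> rxx; case: n => //= n; elim: n => //= n ->; rewrite rxx. Qed.

(** Exhibits an overlap as a function of the two lists of values taken at the
cut points, which is how reparametrizations and limits act on it. *)
Lemma extend_df_cutpoint (R : realType) (q : nat) (A : R -> R)
    (v : q.-tuple R) (i : nat) :
  extend_df A (cutpoint v i) =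
  nth (lim (A @ +oo)) (lim (A @ -oo) :: [seq A x | x <- v]) i.
Proof.
case: i => [//|i]; rewrite /cutpoint /= nth_rcons size_map.
case: ltnP => [iq|qi]; first by rewrite (nth_map 0)//= (nth_map 0).
by rewrite if_same nth_default ?size_map.
Qed.

(** The cut points enter an overlap only through the values of the two
functions, so a change of the time variable leaves it unchanged. *)
Lemma overlap_map (R : realType) (q : nat) (f : R -> R) (A B A' B' : R -> R)
    (v : q.-tuple R) :
  lim (A' @ -oo) = lim (A @ -oo) -> lim (A' @ +oo) = lim (A @ +oo) ->
  lim (B' @ -oo) = lim (B @ -oo) -> lim (B' @ +oo) = lim (B @ +oo) ->
  {in v, A' \o f =1 A} -> {in v, B' \o f =1 B} ->
  overlap A' B' (map_tuple f v) = overlap A B v.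
Proof.
move=> ANy Ay BNy By /eq_in_map fA /eq_in_map fB; apply: eq_bigr => i _.
by rewrite /increment !extend_df_cutpoint ANy Ay BNy By /= -!map_comp fA fB.
Qed.

(** The two infinite cut points do not move, hence convergence of the values at
real points is enough, be it one-sided or not even coming from convergence of
the points themselves. *)
Lemma overlap_cvg (R : realType) (q : nat) (f : nat -> R -> R) (A B : R -> R)
    (v : q.-tuple R) :
  (forall x, A (f m x) @[m --> \oo] --> A x) ->
  (forall x, B (f m x) @[m --> \oo] --> B x) ->
  overlap A B (map_tuple (f m) v) @[m --> \oo] --> overlap A B v.
Proof.
have cvg_values (C : R -> R) : (forall x, C (f m x) @[m --> \oo] --> C x) ->
    forall i, extend_df C (cutpoint (map_tuple (f m) v) i) @[m --> \oo] -->
              extend_df C (cutpoint v i).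
  move=> fC [|i]; first exact: cvg_cst.
  have [iq|qi] := ltnP i q; last first.
    have cutK (w : q.-tuple R) : extend_df C (cutpoint w i.+1) = lim (C @ +oo).
      by rewrite extend_df_cutpoint/= nth_default// size_map size_tuple.
    by rewrite cutK; under eq_cvg do rewrite cutK; exact: cvg_cst.
  have cutE (w : q.-tuple R) : extend_df C (cutpoint w i.+1) = C w`_i.
    by rewrite extend_df_cutpoint/= (nth_map 0)// size_tuple.
  rewrite cutE; under eq_cvg do rewrite cutE (nth_map 0) ?size_tuple//.
  exact: fC.
move=> fA fB; apply: cvg_big => [|i _]; first exact: add_continuous.
rewrite minr_absE; under eq_cvg do rewrite minr_absE.
have cA : increment A (cutpoint (map_tuple (f m) v) i)
    (cutpoint (map_tuple (f m) v) i.+1) @[m --> \oo] -->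
    increment A (cutpoint v i) (cutpoint v i.+1).
  by apply: cvgB; exact: cvg_values.
have cB : increment B (cutpoint (map_tuple (f m) v) i)
    (cutpoint (map_tuple (f m) v) i.+1) @[m --> \oo] -->
    increment B (cutpoint v i) (cutpoint v i.+1).
  by apply: cvgB; exact: cvg_values.
apply: cvgMl; apply: cvgB; first exact: cvgD.
by apply: cvg_norm; exact: cvgB.
Qed.

(** A crude bound, whose only purpose is to make the infima over all cut points
meaningful: each increment is at least [-1]. *)
Lemma overlap_ge (R : realType) (q : nat) (A B : R -> R) (v : q.-tuple R) :
  (forall c, 0 <= extend_df A c <= 1) -> (forall c, 0 <= extend_df B c <= 1) ->
  - q.+1%:R <= overlap A B v.
Proof.
move=> A01 B01; rewrite -[q.+1]card_ord -sumr_const -sumrN.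
apply: ler_sum => i _; rewrite le_min /increment.
have incr_ge (C : R -> R) c d : (forall c, 0 <= extend_df C c <= 1) ->
    - 1 <= extend_df C d - extend_df C c.
  move=> C01; have /andP[_ C1] := C01 c; have /andP[C0 _] := C01 d.
  by rewrite lerBrDr (le_trans _ C0)// addrC subr_le0.
by rewrite !incr_ge.
Qed.

Lemma overlaps_has_lbound (R : realType) (q : nat) (A B : R -> R) :
  (forall c, 0 <= extend_df A c <= 1) -> (forall c, 0 <= extend_df B c <= 1) ->
  has_lbound [set overlap A B v | v in [set v : q.-tuple R | sorted <=%R v]].
Proof.
by move=> A01 B01; exists (- q.+1%:R) => _ [v _ <-]; exact: overlap_ge.
Qed.

Lemma overlaps_nonempty (R : realType) (q : nat) (A B : R -> R) :
  [set overlap A B v | v in [set v : q.-tuple R | sorted <=%R v]] !=set0.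
Proof.
exists (overlap A B (nseq_tuple q 0)), (nseq_tuple q 0) => //=.
exact: sorted_nseq.
Qed.

(** Comparing infima by approximation: the form in which a smaller family of cut
points is shown to reach the same infimum as a larger one. *)
Lemma inf_le_of_cvg (R : realType) (S T : set R) :
  has_lbound S -> T !=set0 ->
  (forall y, T y -> exists2 u : nat -> R,
     (forall m, S (u m)) & u m @[m --> \oo] --> y) ->
  inf S <= inf T.
Proof.
move=> Sb T0 TS; apply: lb_le_inf => // y /TS[u Su uy].
by apply: (cvgr_to_ge uy); apply: nearW => m; exact: ge_inf.
Qed.

(** * Measurability through rational cut points *)

(** The least multiple of [1/(m+1)] that is strictly above [x].  Unlike the
choice of an arbitrary nearby rational, this rounding is monotone, so that it
preserves sorted tuples, ties included. *)
Definition rat_above (R : realType) (m : nat) (x : R) : rat :=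
  (Num.floor (x * m.+1%:R) + 1)%:~R / m.+1%:R.

Lemma rat_above_nondecreasing (R : realType) (m : nat) :
  {homo @rat_above R m : x y / x <= y}.
Proof.
move=> x y xy; rewrite /rat_above ler_pM2r ?invr_gt0 ?ltr0n// ler_int.
by rewrite lerD2r le_floor// ler_pM2r ?ltr0n.
Qed.

Lemma ratr_rat_above_itv (R : realType) (m : nat) (x : R) :
  x < ratr (rat_above m x) <= x + m.+1%:R^-1.
Proof.
have m0 : (0 : R) < m.+1%:R by rewrite ltr0n.
rewrite /rat_above fmorph_div /= ratr_nat ratr_int ltr_pdivlMr// floorD1_gt /=.
by rewrite ler_pdivrMr// mulrDl mulVf ?gt_eqF// intrD lerD2r floor_le.
Qed.

(** Rounding is strictly upwards, which is the side on which distribution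
functions are continuous. *)
Lemma rat_above_cvg (R : realType) (A : R -> R) :
  (forall x, A y @[y --> x^'+] --> A x) ->
  forall x, A (ratr (rat_above m x)) @[m --> \oo] --> A x.
Proof.
move=> rA x; move/cvg_at_rightP: (rA x); apply; split=> [m|].
  by case/andP: (ratr_rat_above_itv m x).
apply: (@squeeze_cvgr _ _ _ _ (fun=> x) (fun m => x + m.+1%:R^-1)).
- by apply: nearW => m; case/andP: (ratr_rat_above_itv m x) => /ltW -> ->.
- exact: cvg_cst.
- rewrite -[X in _ --> X]addr0; apply: cvgD; first exact: cvg_cst.
  exact: cvg_harmonic.
Qed.

(** Right-continuity reduces the infimum to countably many tuples; this is the
source of measurability. *)
Lemma inf_overlap_rat (R : realType) (q : nat) (A B : R -> R) :
  (forall x, A y @[y --> x^'+] --> A x) ->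
  (forall x, B y @[y --> x^'+] --> B x) ->
  (forall c, 0 <= extend_df A c <= 1) -> (forall c, 0 <= extend_df B c <= 1) ->
  inf [set overlap A B v | v in [set v : q.-tuple R | sorted <=%R v]] =
  inf [set overlap A B (map_tuple ratr w) |
       w in [set w : q.-tuple rat | sorted <=%R w]].
Proof.
move=> rA rB A01 B01; apply/eqP; rewrite eq_le; apply/andP; split.
  apply: lb_le_inf.
    exists (overlap A B (map_tuple ratr (nseq_tuple q (0 : rat)))).
    by exists (nseq_tuple q 0) => //=; exact: sorted_nseq.
  move=> _ [w sw <-]; apply: ge_inf; first exact: overlaps_has_lbound.
  exists (map_tuple ratr w) => //=; apply: homo_sorted sw => a b.
  by rewrite ler_rat.
apply: inf_le_of_cvg; last 1 first.
- move=> _ [v sv <-].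
  exists (fun m => overlap A B (map_tuple ratr (map_tuple (rat_above m) v))).
    move=> m; exists (map_tuple (rat_above m) v) => //=.
    exact: (homo_sorted (@rat_above_nondecreasing _ m)) sv.
  have mapE m : map_tuple ratr (map_tuple (rat_above m) v) =
                map_tuple (fun x => ratr (rat_above m x)) v :> q.-tuple R.
    by apply: val_inj; rewrite /= -map_comp.
  under eq_cvg do rewrite mapE.
  exact: overlap_cvg (rat_above_cvg rA) (rat_above_cvg rB).
- by exists (- q.+1%:R) => _ [w _ <-]; exact: overlap_ge.
- exact: overlaps_nonempty.
Qed.

Lemma measurable_Ddist (R : realType) (q : nat) (d : measure_display)
    (T : measurableType d) (A : T -> R -> R) (B : R -> R) :
  (forall c, measurable_fun setT (fun w => extend_df (A w) c)) ->
  (forall w x, A w y @[y --> x^'+] --> A w x) ->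
  (forall w c, 0 <= extend_df (A w) c <= 1) ->
  (forall x, B y @[y --> x^'+] --> B x) ->
  (forall c, 0 <= extend_df B c <= 1) ->
  measurable_fun setT (fun w => Ddist q (A w) B).
Proof.
move=> mA rA A01 rB B01.
(* Unsorted tuples are replaced by a constant, hence sorted, one, so that the
sorted rational tuples form the range of a sequence [e]. *)
pose good (w : q.-tuple rat) := if sorted <=%R w then w else nseq_tuple q 0.
have good_sorted w : sorted <=%R (good w).
  rewrite /good; case: ifP => // _; exact: sorted_nseq.
pose e k := good (odflt (nseq_tuple q 0) (unpickle k)).
pose h k w := overlap (A w) B (map_tuple ratr (e k)).
have -> : (fun w => Ddist q (A w) B) = (fun w => 1 - infs (h ^~ w) 0%N).
  apply/funext => w; rewrite /Ddist inf_overlap_rat//; congr (1 - inf _).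
  apply/seteqP; split=> [_ [v sv <-]|_ [k _ <-]]; last first.
    by exists (e k) => //; exact: good_sorted.
  by exists (pickle v) => //; rewrite /h /e pickleK /= /good sv.
apply: measurable_funB => //; apply: measurable_fun_infs => [w _|k].
  by exists (- q.+1%:R) => _ [k _ <-]; exact: overlap_ge.
apply: measurable_sum => i; apply: measurable_minr; last exact: measurable_cst.
exact: measurable_funB.
Qed.

(** * Empirical distribution functions *)

Lemma empirical_dfE (R : realType) (n : nat) (x : 'I_n -> R) (t : R) :
  empirical_df x t = n%:R^-1 * \sum_(i < n) (x i <= t)%R%:R.
Proof.
by congr (_ * _); apply: eq_bigr => i _; rewrite indicE mem_setE/= in_itv.
Qed.

(** An empirical distribution function is a combination of finitely many
indicators, so its limits are read off from their eventual values. *)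
Lemma empirical_df_cvg (R : realType) (n : nat) (x : 'I_n -> R) (I : Type)
    (F : set_system I) {FF : Filter F} (u : I -> R) (b : 'I_n -> bool) :
  (forall i, \forall j \near F, (x i <= u j) = b i) ->
  empirical_df x (u j) @[j --> F] -->
    (n%:R^-1 * \sum_(i < n) (b i)%:R : R).
Proof.
move=> xb; under eq_cvg do rewrite empirical_dfE.
apply: cvgMr; apply: cvg_big => [|i _]; first exact: add_continuous.
by apply: cvg_near_cst; apply: filterS (xb i) => j ->.
Qed.

Lemma empirical_df_Ny (R : realType) (n : nat) (x : 'I_n -> R) :
  lim (empirical_df x @ -oo) = 0.
Proof.
have -> : (0 : R) = n%:R^-1 * \sum_(i < n) false%:R by rewrite big1 ?mulr0.
apply: cvg_lim => //.
apply: (@empirical_df_cvg _ _ _ _ _ _ id (fun=> false)) => i.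
by apply: filterS (nbhs_ninfty_lt (num_real (x i))) => t; rewrite leNgt => ->.
Qed.

Lemma empirical_df_y (R : realType) (n : nat) (x : 'I_n -> R) : (0 < n)%N ->
  lim (empirical_df x @ +oo) = 1.
Proof.
move=> n0; have -> : (1 : R) = n%:R^-1 * \sum_(i < n) true%:R.
  by rewrite sumr_const card_ord mulVf// pnatr_eq0 -lt0n.
apply: cvg_lim => //.
apply: (@empirical_df_cvg _ _ _ _ _ _ id (fun=> true)) => i.
by apply: filterS (nbhs_pinfty_ge (num_real (x i))) => t ->.
Qed.

Lemma empirical_df_rc (R : realType) (n : nat) (x : 'I_n -> R) t :
  empirical_df x s @[s --> t^'+] --> empirical_df x t.
Proof.
rewrite empirical_dfE; apply: empirical_df_cvg => i.
have [xt|tx] := leP (x i) t.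
  by apply: filterS (nbhs_right_gt t) => s /ltW; exact: le_trans.
by apply: filterS (nbhs_right_lt tx) => s; rewrite leNgt => ->.
Qed.

Lemma empirical_df01 (R : realType) (n : nat) (x : 'I_n -> R) : (0 < n)%N ->
  forall c, 0 <= extend_df (empirical_df x) c <= 1.
Proof.
move=> n0 [t| |] /=; last 2 first.
- by rewrite empirical_df_y// ler01 lexx.
- by rewrite empirical_df_Ny lexx ler01.
rewrite empirical_dfE mulr_ge0 ?invr_ge0 ?sumr_ge0//=.
rewrite mulrC ler_pdivrMr ?ltr0n// mul1r -[n in leRHS]card_ord -sumr_const.
by apply: ler_sum => i _; case: (x i <= t)%R.
Qed.

Lemma measurable_empirical_df (R : realType) (n : nat) (d : measure_display)
    (T : measurableType d) (X : 'I_n -> T -> R) : (0 < n)%N ->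
  (forall i, measurable_fun setT (X i)) ->
  forall c, measurable_fun setT (fun w => extend_df (empirical_df (X^~ w)) c).
Proof.
move=> n0 mX [t| |] /=; last 2 first.
- by under eq_fun do rewrite empirical_df_y//; exact: measurable_cst.
- by under eq_fun do rewrite empirical_df_Ny//; exact: measurable_cst.
apply: measurable_funM => //; apply: measurable_sum => i.
by apply: (measurableT_comp _ (mX i)); exact: measurable_indic.
Qed.

(** * Change of the time scale to the uniform one *)

Lemma extend_df01 (R : realType) (F : distrib_fun R) (c : \bar R) :
  0 <= extend_df F c <= 1.
Proof.
case: c => [x| |]; last 2 first.
- by rewrite extend_dfy ler01 lexx.
- by rewrite extend_dfNy lexx ler01.
apply/andP; split => /=.
  apply: (cvgr_to_le (cumulativeNy F)).
  apply: filterS (nbhs_ninfty_le (num_real x)).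
  by move=> t; exact: cumulative_is_nondecreasing.
apply: (cvgr_to_ge (cumulativey F)).
apply: filterS (nbhs_pinfty_ge (num_real x)).
by move=> t; exact: cumulative_is_nondecreasing.
Qed.

Lemma distrib_fun_onto (R : realType) (F : distrib_fun R) (u : R) :
  continuous F -> 0 < u < 1 -> exists t, F t = u.
Proof.
move=> cF /andP[u0 u1].
have [a Fa] := filter_ex (cvgr_lt _ (cumulativeNy F) _ u0).
have [b Fb] := filter_ex (cvgr_gt _ (cumulativey F) _ u1).
have ab : a <= b.
  rewrite leNgt; apply/negP => /ltW /(cumulative_is_nondecreasing F).
  by rewrite leNgt (lt_trans Fa Fb).
have [|t _ Ft] := @IVT R F a b u ab (continuous_subspaceT cF); last by exists t.
by rewrite ge_min le_max (ltW Fa) (ltW Fb) orbT.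
Qed.

(** The distribution function of the uniform law on [[0, 1]]. *)
Definition unif_df (R : realType) (u : R) : R := Num.max 0 (Num.min u 1).

Lemma unif_df_id (R : realType) (u : R) : 0 <= u <= 1 -> unif_df u = u.
Proof. by case/andP=> u0 u1; rewrite /unif_df (min_l u1) (max_r u0). Qed.

Lemma unif_df_itv (R : realType) (u : R) : 0 <= unif_df u <= 1.
Proof. by rewrite /unif_df le_max lexx ge_max ler01 ge_min lexx orbT. Qed.

Lemma unif_df_subr (R : realType) (c e : R) :
  0 <= e -> unif_df c <= unif_df (c - e) + e.
Proof.
move=> e0; have /andP[W0 _] := unif_df_itv (c - e).
rewrite {1}/unif_df ge_max addr_ge0//= -lerBlDr /unif_df le_max.
apply/orP; right; rewrite le_min lerB ?ge_min ?lexx//= lerBlDr.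
by rewrite (le_trans (_ : _ <= 1)) ?ge_min ?lexx ?orbT// lerDl.
Qed.

Lemma unif_df_continuous (R : realType) : continuous (@unif_df R).
Proof.
move=> u.
have cmin : {for u, continuous (fun u : R => Num.min u 1)}.
  apply: (@continuous_min R R (id : R -> R^o) (cst 1) u); first exact: cvg_id.
  exact: cst_continuous.
have := @continuous_max R R (cst 0) ((fun u => Num.min u 1) : R -> R^o) u.
apply=> //.
exact: cst_continuous.
Qed.

Lemma unif_df_Ny (R : realType) : lim (@unif_df R @ -oo) = 0.
Proof.
apply: cvg_lim => //; apply: cvg_near_cst.
apply: filterS (nbhs_ninfty_le (num_real (0 : R))) => u u0.
by rewrite /unif_df max_l// ge_min u0.
Qed.

Lemma unif_df_y (R : realType) : lim (@unif_df R @ +oo) = 1.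
Proof.
apply: cvg_lim => //; apply: cvg_near_cst.
apply: filterS (nbhs_pinfty_ge (num_real (1 : R))) => u u1.
by rewrite /unif_df min_r// max_r.
Qed.

Lemma extend_unif_df01 (R : realType) (c : \bar R) :
  0 <= extend_df (@unif_df R) c <= 1.
Proof.
case: c => [u| |] /=; first exact: unif_df_itv.
- by rewrite unif_df_y ler01 lexx.
- by rewrite unif_df_Ny lexx ler01.
Qed.

(** A monotone retraction onto a compact subinterval of the open unit interval,
all of whose points are values of every continuous distribution function; the
levels [0] and [1] need not be. *)
Definition squash (R : realType) (m : nat) (u : R) : R :=
  Num.max m.+2%:R^-1 (Num.min u (1 - m.+2%:R^-1)).

Lemma squash_nondecreasing (R : realType) (m : nat) :
  {homo @squash R m : u v / u <= v}.
Proof.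
move=> u v uv; rewrite /squash ge_max !le_max lexx/= le_min.
by rewrite !ge_min uv lexx !orbT.
Qed.

Lemma squash_itv (R : realType) (m : nat) (u : R) : 0 < squash m u < 1.
Proof.
have e0 : (0 : R) < m.+2%:R^-1 by rewrite invr_gt0 ltr0n.
have e1 : m.+2%:R^-1 < (1 : R) by rewrite invf_lt1 ?ltr0n// ltr1n.
by rewrite /squash lt_max e0 gt_max e1 gt_min [1 - _ < 1]gtrBl e0 orbT.
Qed.

Lemma squash_unif_dist (R : realType) (m : nat) (u : R) :
  unif_df u - m.+2%:R^-1 <= squash m u <= unif_df u + m.+2%:R^-1.
Proof.
have : (0 : R) <= m.+2%:R^-1 by rewrite invr_ge0 ler0n.
rewrite /squash; move: (m.+2%:R^-1) => e e0; apply/andP; split.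
  rewrite lerBlDr /unif_df ge_max -lerBDr sub0r le_max.
  rewrite (le_trans _ e0) ?oppr_le0//= -lerBlDr le_max; apply/orP; right.
  rewrite le_min lerB// ?ge_min ?lexx ?orbT// andbT.
  by rewrite lerBlDr (le_trans _ (_ : u <= _)) ?ge_min ?lexx// lerDl.
rewrite ge_max lerDr; have /andP[-> _] := unif_df_itv u.
apply: ler_wpDr => //; rewrite /unif_df le_max; apply/orP; right.
by rewrite le_min !ge_min lexx/= [1 - e <= 1]gerBl e0 orbT.
Qed.

Lemma cvg_invSS (R : realType) : (m.+2%:R^-1 : R) @[m --> \oo] --> (0 : R).
Proof. by have := @cvg_harmonic R; rewrite -cvg_shiftS. Qed.

(** For [u] outside the unit interval [squash m u] does not tend to [u], but the
uniform distribution function cannot tell the difference in the limit. *)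
Lemma unif_df_squash_cvg (R : realType) (u : R) :
  unif_df (squash m u) @[m --> \oo] --> unif_df u.
Proof.
have Wsq m : unif_df (squash m u) = squash m u.
  by apply: unif_df_id; have /andP[/ltW -> /ltW ->] := squash_itv m u.
under eq_cvg do rewrite Wsq.
have e0 := @cvg_invSS R.
apply: (@squeeze_cvgr _ _ _ _ (fun m => unif_df u - m.+2%:R^-1)
  (fun m => unif_df u + m.+2%:R^-1)).
- by apply: nearW => m; exact: squash_unif_dist.
- by rewrite -[X in _ --> X]subr0; apply: cvgB => //; exact: cvg_cst.
- by rewrite -[X in _ --> X]addr0; apply: cvgD => //; exact: cvg_cst.
Qed.

(** No sample point lies at or beyond the end points, so for large [m] squashing
does not carry a cut point across any of them. *)
Lemma empirical_df_squash_cvg (R : realType) (n : nat) (x : 'I_n -> R) (u : R) :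
  (forall i, 0 < x i < 1) ->
  empirical_df x (squash m u) @[m --> \oo] --> empirical_df x u.
Proof.
move=> x01; rewrite empirical_dfE; apply: empirical_df_cvg => i.
have /andP[x0 x1] := x01 i.
have e0 := @cvg_invSS R.
have y0 : 0 < 1 - x i by rewrite subr_gt0.
have [near_x near_y] := (cvgr_lt _ e0 _ x0, cvgr_lt _ e0 _ y0).
apply: filterS2 near_x near_y => m mx my; apply/idP/idP.
  rewrite /squash le_max [x i <= _^-1]leNgt mx/= le_min => /andP[-> //].
by move=> xu; rewrite /squash le_max le_min xu lerBrDr -lerBrDl (ltW my) orbT.
Qed.

(** The strict inequality says that no sample point lies in a flat part of [F]
to the right of its left end, so that the empirical function of [x] is that of
[F \o x] read in the time scale [F]; the same holds for [F] and the uniform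
function.  Every tuple of times thus has an image with the same overlap.
Conversely tuples of levels in the open unit interval are reached by a right
inverse of [F], and the overlaps at the others are limits of such. *)
Lemma Ddist_empirical_unif (R : realType) (q n : nat) (F : distrib_fun R)
    (x : 'I_n -> R) : (0 < n)%N -> continuous F ->
  (forall i, 0 < F (x i) < 1) -> (forall i t, t < x i -> F t < F (x i)) ->
  Ddist q (empirical_df x) F = Ddist q (empirical_df (F \o x)) (@unif_df R).
Proof.
move=> n0 cF F01 Finc; have Fnd := cumulative_is_nondecreasing F.
have FE t : empirical_df (F \o x) (F t) = empirical_df x t.
  rewrite !empirical_dfE; congr (_ * _); apply: eq_bigr => i _; congr (_%:R).
  apply: congr1; apply/idP/idP => /=; last exact: Fnd.
  by apply: contraTT; rewrite -!ltNge; exact: Finc.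
have FW t : unif_df (F t) = F t by exact: unif_df_id (extend_df01 F t%:E).
have FNy : lim (F @ -oo) = 0 := extend_dfNy F.
have Fy : lim (F @ +oo) = 1 := extend_dfy F.
have push v : overlap (empirical_df (F \o x)) (@unif_df R) (map_tuple F v) =
              overlap (empirical_df x) F v :> R.
  apply: overlap_map => [||||t _|t _] /=; rewrite ?FE ?FW//.
  - by rewrite !empirical_df_Ny.
  - by rewrite !empirical_df_y.
  - by rewrite unif_df_Ny FNy.
  - by rewrite unif_df_y Fy.
congr (1 - _); apply/eqP; rewrite eq_le; apply/andP; split.
  apply: inf_le_of_cvg.
  - apply: overlaps_has_lbound => c; first exact: empirical_df01.
    exact: extend_df01.
  - exact: overlaps_nonempty.
  - move=> _ [u su <-].
    (* Monotonicity of [F] makes any right inverse of it monotone on the open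
       unit interval, so no particular quantile has to be chosen. *)
    pose k (p : R) : R := xget 0 [set t | F t = p].
    have kK p : 0 < p < 1 -> F (k p) = p.
      by move=> /(distrib_fun_onto cF); exact: xgetPex.
    have k_nd m : {homo k \o squash m : a b / a <= b}.
      move=> a b ab /=; rewrite leNgt; apply/negP => kba.
      have /= := Fnd _ _ (ltW kba); rewrite !kK ?squash_itv// => ba.
      have E : squash m a = squash m b.
        by apply/eqP; rewrite eq_le ba squash_nondecreasing.
      by move: kba; rewrite E ltxx.
    exists (fun m => overlap (empirical_df x) F (map_tuple (k \o squash m) u)).
      move=> m; exists (map_tuple (k \o squash m) u) => //=.
      exact: (homo_sorted (k_nd m)) su.
    have E m : overlap (empirical_df x) F (map_tuple (k \o squash m) u) =
        overlap (empirical_df (F \o x)) (@unif_df R) (map_tuple (squash m) u).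
      rewrite -push; congr overlap; apply: val_inj; rewrite /= -map_comp.
      by apply: eq_map => a /=; rewrite kK ?squash_itv.
    under eq_cvg do rewrite E.
    apply: overlap_cvg => a; last exact: unif_df_squash_cvg.
    exact: empirical_df_squash_cvg.
apply: lb_le_inf; first exact: overlaps_nonempty.
move=> _ [v sv <-]; apply: ge_inf.
  apply: overlaps_has_lbound => c; first exact: empirical_df01.
  exact: extend_unif_df01.
exists (map_tuple F v); first exact: (homo_sorted Fnd) sv.
exact: push.
Qed.

(** * The probability integral transform *)

(** Rays form an intersection-stable class generating the Borel sets. *)
Lemma borel_law_eq (R : realType) (d1 d2 : measure_display)
    (T1 : measurableType d1) (T2 : measurableType d2)
    (P1 : probability T1 R) (P2 : probability T2 R) (U : T1 -> R) (V : T2 -> R)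
    (mU : measurable_fun setT U) (mV : measurable_fun setT V) :
  (forall c, P1 [set w | U w <= c] = P2 [set w | V w <= c]) ->
  forall B, measurable B -> P1 (U @^-1` B) = P2 (V @^-1` B).
Proof.
move=> UV B mB.
pose U' : {mfun T1 >-> R} := HB.pack U (isMeasurableFun.Build _ _ _ _ U mU).
pose V' : {mfun T2 >-> R} := HB.pack V (isMeasurableFun.Build _ _ _ _ V mV).
have ray (d : measure_display) (T : measurableType d) (P : probability T R)
    (Z : {mfun T >-> R}) c :
    distribution P Z `]c, +oo[ = (1 - P [set w | (Z w <= c)%R])%E.
  rewrite -probability_setC; last first.
    have -> : [set w | Z w <= c] = Z @^-1` `]-oo, c].
      by apply/seteqP; split => w; rewrite /= in_itv.
    exact: measurable_funPTI.
  congr (P _); apply/seteqP.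
  by split => w; rewrite /= in_itv/= andbT ltNge => /negP.
change (distribution P1 U' B = distribution P2 V' B).
apply: (measure_unique (@RGenOInfty.G R)
  (fun k => `](- k%:R), +oo[%classic)) => //.
- exact: RGenOInfty.measurableE.
- move=> _ _ [a ->] [b ->]; exists (Num.max a b).
  by apply/seteqP; split => x; rewrite /= !in_itv/= !andbT gt_max => /andP.
- by move=> k; exists (- k%:R).
- rewrite -subTset => x _; exists (Num.bound `|x|) => //=.
  rewrite in_itv/= andbT ltrNl.
  by rewrite (le_lt_trans _ (archi_boundP _))// -normrN ler_norm.
- move=> _ [c ->]; apply: (etrans (ray _ _ P1 U' c)).
  by rewrite UV; exact: esym (ray _ _ P2 V' c).
- by move=> k; rewrite (le_lt_trans (probability_le1 _ _))// ltry.
Qed.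

(** Measurable boxes form an intersection-stable class generating the product
sigma-algebra. *)
Lemma tuple_law_eq (R : realType) (n : nat) (d1 d2 : measure_display)
    (T1 : measurableType d1) (T2 : measurableType d2)
    (P1 : probability T1 R) (P2 : probability T2 R)
    (U : T1 -> n.-tuple R) (V : T2 -> n.-tuple R)
    (mU : measurable_fun setT U) (mV : measurable_fun setT V) :
  (forall B : 'I_n -> set R, (forall i, measurable (B i)) ->
    P1 [set w | forall i, B i (tnth (U w) i)] =
    P2 [set w | forall i, B i (tnth (V w) i)]) ->
  forall E, measurable E -> P1 (U @^-1` E) = P2 (V @^-1` E).
Proof.
move=> UV E mE.
pose U' : {mfun T1 >-> n.-tuple R} :=
  HB.pack U (isMeasurableFun.Build _ _ _ _ U mU).
pose V' : {mfun T2 >-> n.-tuple R} :=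
  HB.pack V (isMeasurableFun.Build _ _ _ _ V mV).
pose box (B : 'I_n -> set R) := [set x : n.-tuple R | forall i, B i (tnth x i)].
pose G := [set box B | B in [set B | forall i, measurable (B i)]].
change (distribution P1 U' E = distribution P2 V' E).
apply: (measure_unique G (fun=> setT)) => //.
- apply/seteqP; split.
    apply: smallest_sub; first exact: smallest_sigma_algebra.
    move=> A; rewrite -bigcup_seq => -[i _ [B mB <-]].
    apply: sub_sigma_algebra; rewrite setTI.
    exists (fun j => if j == i then B else setT) => [j|] /=; first by case: ifP.
    apply/seteqP; split => x /=; first by move/(_ i); rewrite eqxx.
    by move=> Bx j; case: eqP => [->|].
  apply: smallest_sub; first exact: sigma_algebra_measurable.
  move=> _ [B mB <-].
  have -> : box B = \bigcap_(i in [set: 'I_n]) ((@tnth n R ^~ i) @^-1` B i).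
    by apply/seteqP; split => x Bx i; [move=> _; exact: Bx|exact: Bx i I].
  apply: fin_bigcap_measurable => // i _.
  by rewrite -[_ @^-1` _]setTI; exact: measurable_tnth.
- move=> _ _ [B mB <-] [C mC <-]; exists (fun i => B i `&` C i).
    by move=> i; exact: measurableI.
  apply/seteqP; split => x /=; first by move=> BC; split=> i; case: (BC i).
  by case=> Bx Cx i.
- by move=> _; exists (fun=> setT) => //; apply/seteqP; split.
- by apply/seteqP; split => // x _; exists 0%N.
- by move=> _ [B mB <-]; exact: UV.
- by move=> k; rewrite (le_lt_trans (probability_le1 _ _))// ltry.
Qed.

(** The probability integral transform.  For [0 < c < 1] the event [F X <= c] is
squeezed between [X <= t] with [F t = c] and [X <= t] with [F t = c + e], which
spares locating the right end of the flat part of [F] at level [c]. *)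
Lemma law_df_unif (R : realType) (d : measure_display) (T : measurableType d)
    (P : probability T R) (X : {RV P >-> R}) (F : distrib_fun R) :
  continuous F -> (forall x, cdf X x = (F x)%:E) ->
  forall c, P [set w | F (X w) <= c] = (unif_df c)%:E.
Proof.
move=> cF XF c; have Fnd := cumulative_is_nondecreasing F.
have mle (Z : T -> R) b :
    measurable_fun setT Z -> measurable [set w | Z w <= b].
  move=> mZ; rewrite (_ : [set w | _] = Z @^-1` `]-oo, b]).
    by rewrite -[_ @^-1` _]setTI; exact: mZ.
  by apply/seteqP; split => w; rewrite /= in_itv.
have mFX : measurable_fun setT (F \o X).
  exact: measurableT_comp (continuous_measurable_fun cF) _.
have cdfE t : P [set w | X w <= t] = (F t)%:E by exact: XF.
have F01 t : 0 <= F t <= 1 := extend_df01 F t%:E.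
have [c0|c0] := ltP c 0.
  rewrite (_ : [set w | _] = set0) ?measure0.
    by rewrite /unif_df max_l// ge_min (ltW c0).
  rewrite -subset0 => w /=; have /andP[F0 _] := F01 (X w).
  by rewrite leNgt (lt_le_trans c0 F0).
have [c1|c1] := leP 1 c.
  rewrite (_ : [set w | _] = setT) ?probability_setT.
    by rewrite /unif_df min_r// max_r.
  rewrite -subTset => w _ /=; have /andP[_ F1] := F01 (X w).
  exact: le_trans F1 c1.
rewrite unif_df_id ?c0 ?(ltW c1)//; apply/eqP; rewrite eq_le; apply/andP; split.
  apply/lee_addgt0Pr => e e0; rewrite -EFinD.
  have [ce1|ce1] := leP 1 (c + e).
    by rewrite (le_trans (probability_le1 _ (mle _ _ mFX))) ?lee_fin.
  have [|t Ft] := @distrib_fun_onto _ F (c + e) cF.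
    by rewrite ce1 ltr_wpDl.
  rewrite -Ft -cdfE le_measure ?inE//; [exact: mle mFX|exact: mle|].
  move=> w /= Fc; rewrite leNgt; apply/negP => /ltW /Fnd /=.
  by rewrite Ft leNgt (le_lt_trans Fc)// ltrDl.
have [->|cn0] := eqVneq c 0; first exact: measure_ge0.
have [|t Ft] := @distrib_fun_onto _ F c cF.
  by rewrite c1 lt_neqAle eq_sym cn0 c0.
rewrite -[in leLHS]Ft -cdfE le_measure ?inE//; [exact: mle|exact: mle mFX|].
by move=> w /= /Fnd /=; rewrite Ft.
Qed.

(** The uniform law gives the interval from [c - e] to [c] at most mass [e]. *)
Lemma df_no_atom (R : realType) (d : measure_display) (T : measurableType d)
    (P : probability T R) (X : {RV P >-> R}) (F : distrib_fun R) :
  continuous F -> (forall x, cdf X x = (F x)%:E) ->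
  forall c, {ae P, forall w, F (X w) <> c}.
Proof.
move=> cF XF c; have law := law_df_unif cF XF.
have mFX : measurable_fun setT (F \o X).
  exact: measurableT_comp (continuous_measurable_fun cF) _.
have mpre B : measurable B -> measurable ((F \o X) @^-1` B).
  by move=> mB; rewrite -[_ @^-1` _]setTI; exact: mFX.
exists ((F \o X) @^-1` [set c]); split; first exact: mpre.
  apply/eqP; rewrite eq_le measure_ge0 andbT.
  apply/lee_addgt0Pr => e e0; rewrite add0e.
  have le_c : measurable [set w | F (X w) <= c].
    rewrite (_ : [set w | _] = (F \o X) @^-1` `]-oo, c]); first exact: mpre.
    by apply/seteqP; split => w; rewrite /= in_itv.
  have le_ce : measurable [set w | F (X w) <= c - e].
    rewrite (_ : [set w | _] = (F \o X) @^-1` `]-oo, c - e]); first exact: mpre.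
    by apply/seteqP; split => w; rewrite /= in_itv.
  have sub : (F \o X) @^-1` [set c] `|` [set w | F (X w) <= c - e] `<=`
             [set w | F (X w) <= c].
    by move=> w [/= ->//|/= /le_trans]; apply; rewrite lerBlDr lerDl ltW.
  have disj : (F \o X) @^-1` [set c] `&` [set w | F (X w) <= c - e] = set0.
    rewrite -subset0 => w /= [->]; apply/negP; rewrite -ltNge.
    by rewrite ltrBlDr ltrDl.
  have : (P ((F \o X) @^-1` [set c]) + P [set w | (F (X w) <= c - e)%R] <=
          P [set w | (F (X w) <= c)%R])%E.
    rewrite -measureU//; last exact: mpre.
    by rewrite le_measure ?inE//; apply: measurableU => //; exact: mpre.
  rewrite !law -leeBrDr// => /le_trans; apply.
  by rewrite -EFinB lee_fin lerBlDr addrC unif_df_subr// ltW.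
by move=> w /= /contrapT.
Qed.

(** * Almost sure reduction to the uniform sample *)

(** If [F] took the same value at [t] and at a sample point above [t], it would
take it at a rational between them; so only countably many values have to be
avoided, each of them almost surely. *)
Lemma ae_df_strict (R : realType) (n : nat) (d : measure_display)
    (T : measurableType d) (P : probability T R) (X : 'I_n -> {RV P >-> R})
    (F : distrib_fun R) :
  continuous F -> (forall i x, cdf (X i) x = (F x)%:E) ->
  {ae P, forall w, (forall i, 0 < F (X i w) < 1) /\
                   (forall i t, t < X i w -> F t < F (X i w))}.
Proof.
move=> cF XF; have Fnd := cumulative_is_nondecreasing F.
(* An enumeration of the values of [F] at the rationals, padded with [0]. *)
pose a k : R := if unpickle k is Some r then F (ratr (r : rat)) else 0.
have avoid i : {ae P, forall w, [/\ F (X i w) <> 0, F (X i w) <> 1 &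
    forall k, F (X i w) <> a k]}.
  have no_atom c := df_no_atom cF (XF i) c.
  apply: filterS3 (no_atom 0) (no_atom 1) (ae_foralln (fun k => no_atom (a k))).
  by move=> w ? ? ?; split.
apply: (filterS _ (filter_forall _ avoid)) => w wavoid.
split=> i; have [w0 w1 wa] := wavoid i.
  have /andP[F0 F1] := extend_df01 F (X i w)%:E.
  by rewrite !lt_neqAle F0 F1 eq_sym !andbT; apply/andP; split; exact/eqP.
move=> t tX; have [r] := rat_in_itvoo tX; rewrite in_itv/= => /andP[tr rX].
rewrite lt_neqAle (Fnd _ _ (ltW tX)) andbT; apply/eqP => FtX.
apply: (wa (pickle r)); rewrite /a pickleK; apply/eqP; rewrite eq_le.
by rewrite (Fnd _ _ (ltW rX)) -FtX (Fnd _ _ (ltW tr)).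
Qed.

Lemma measurable_df_comp (R : realType) (d : measure_display)
    (T : measurableType d) (Z : {mfun T >-> R}) (F : R -> R) :
  continuous F -> measurable_fun setT (F \o Z).
Proof.
by move=> cF; exact: measurableT_comp (continuous_measurable_fun cF) _.
Qed.

Lemma measurable_df_tuple (R : realType) (n : nat) (d : measure_display)
    (T : measurableType d) (Z : 'I_n -> {mfun T >-> R}) (F : R -> R) :
  continuous F -> measurable_fun setT (fun w => [tuple F (Z i w) | i < n]).
Proof.
move=> cF; apply/measurable_fun_tnthP => i.
rewrite (_ : _ \o _ = F \o Z i); first exact: measurable_df_comp.
by apply/funext => w /=; rewrite tnth_mktuple.
Qed.

(** Boxes of transformed variables are boxes of the original ones, so
independence factors their probability, and each factor is a uniform
probability. *)
Lemma iid_law_unif (R : realType) (n : nat) (F G : distrib_fun R)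
    (d1 d2 : measure_display) (T1 : measurableType d1) (T2 : measurableType d2)
    (P1 : probability T1 R) (P2 : probability T2 R)
    (X : 'I_n -> {RV P1 >-> R}) (Y : 'I_n -> {RV P2 >-> R}) :
  continuous F -> continuous G -> iid_with_df X F -> iid_with_df Y G ->
  forall E : set (n.-tuple R), measurable E ->
    P1 [set w | E [tuple F (X i w) | i < n]] =
    P2 [set w | E [tuple G (Y i w) | i < n]].
Proof.
move=> cF cG [indX XF] [indY YG].
apply: (tuple_law_eq (measurable_df_tuple X cF)
  (measurable_df_tuple Y cG)) => B mB.
have boxE (d : measure_display) (T : measurableType d) (P : probability T R)
    (Z : 'I_n -> {RV P >-> R}) (H : R -> R) : continuous H ->
    mutually_independent Z ->
    P [set w | forall i, B i (tnth [tuple H (Z i w) | i < n] i)] =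
    (\prod_(i < n) P ((H \o Z i) @^-1` B i))%E.
  move=> cH indZ.
  have := indZ [set: 'I_n]%SET (fun i => H @^-1` B i).
  rewrite (eq_bigl xpredT) => [<-|i]; last by rewrite inE.
    congr (P _); apply/seteqP; split=> w /= Bw i.
      by move=> _; have := Bw i; rewrite tnth_mktuple.
    by rewrite tnth_mktuple; apply: Bw; rewrite /= inE.
  by move=> i; rewrite -[_ @^-1` _]setTI; exact: continuous_measurable_fun.
rewrite !boxE//; apply: eq_bigr => i _.
apply: borel_law_eq => // [||c].
- exact: measurable_df_comp.
- exact: measurable_df_comp.
by rewrite (law_df_unif cF (XF i)) (law_df_unif cG (YG i)).
Qed.

Lemma measure_ae_eq (R : realType) (d : measure_display) (T : measurableType d)
    (P : {measure set T -> \bar R}) (A B : set T) :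
  measurable A -> measurable B -> {ae P, forall w, A w <-> B w} -> P A = P B.
Proof.
move=> mA mB [N [mN N0 AB]].
suff le C D : measurable C -> measurable D ->
    (forall w, ~ N w -> C w -> D w) -> (P C <= P D)%E.
  have ABN w : ~ N w -> (A w <-> B w).
    by move=> Nw; apply: contrapT => ABw; apply: Nw; exact: AB.
  by apply/eqP; rewrite eq_le !le// => w /ABN[].
move=> mC mD CD; rewrite -[leRHS]adde0 -N0.
apply: (le_trans _ (measureU2 _ mD mN)).
apply: le_measure; rewrite ?inE//; first exact: measurableU.
by move=> w Cw; have [Nw|Nw] := pselect (N w); [right|left; exact: CD].
Qed.

Theorem theorem2p4 (R : realType) (q n : nat) (hq : (1 <= q)%N) (hn : (1 <= n)%N)
    (F G : distrib_fun R) (cF : continuous F) (cG : continuous G)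
    (d1 d2 : measure_display) (T1 : measurableType d1) (T2 : measurableType d2)
    (P1 : probability T1 R) (P2 : probability T2 R)
    (X : 'I_n -> {RV P1 >-> R}) (Y : 'I_n -> {RV P2 >-> R})
    (iidX : iid_with_df X F) (iidY : iid_with_df Y G) :
  same_distribution P1 P2
    (fun w => Ddist q (empirical_df (fun i => X i w)) F)
    (fun w => Ddist q (empirical_df (fun i => Y i w)) G).
Proof.
have mD (d : measure_display) (T : measurableType d) (Z : 'I_n -> T -> R)
    (H : R -> R) :
    (forall i, measurable_fun setT (Z i)) ->
    (forall x, H y @[y --> x^'+] --> H x) ->
    (forall c, 0 <= extend_df H c <= 1) ->
    measurable_fun setT (fun w => Ddist q (empirical_df (Z^~ w)) H).
  move=> mZ rH H01; apply: measurable_Ddist => //.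
  - exact: measurable_empirical_df.
  - by move=> w x; exact: empirical_df_rc.
  - by move=> w c; exact: empirical_df01.
have mDX (d : measure_display) (T : measurableType d) (P : probability T R)
    (Z : 'I_n -> {RV P >-> R}) (H : distrib_fun R) :
    measurable_fun setT (fun w => Ddist q (empirical_df (fun i => Z i w)) H).
  apply: (mD _ _ (fun i w => Z i w)) => //.
    exact: cumulative_is_right_continuous.
  exact: extend_df01.
(* The common function of the transformed sample, not involving [F] or [G]. *)
pose h (u : n.-tuple R) := Ddist q (empirical_df (tnth u)) (@unif_df R).
have mh : measurable_fun setT h.
  apply: (mD _ _ (fun i u => tnth u i)) => [i|x|c].
  - exact: measurable_tnth.
  - exact: cvg_within_filter (@unif_df_continuous R x).
  - exact: extend_unif_df01.
split; [exact: mDX|exact: mDX|move=> A mA].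
have reduce (d : measure_display) (T : measurableType d) (P : probability T R)
    (Z : 'I_n -> {RV P >-> R}) (H : distrib_fun R) : continuous H ->
    (forall i x, cdf (Z i) x = (H x)%:E) ->
    pushforward P (fun w => Ddist q (empirical_df (fun i => Z i w)) H) A =
    P [set w | (h @^-1` A) [tuple H (Z i w) | i < n]].
  move=> cH ZH; rewrite /pushforward; apply: (@measure_ae_eq _ _ _ P).
  - by rewrite -[_ @^-1` _]setTI; exact: (mDX _ _ _ Z H measurableT _ mA).
  - rewrite -[[set w | _]]setTI; apply: (measurable_df_tuple Z cH) => //.
    by rewrite -[_ @^-1` _]setTI; exact: mh.
  - apply: (filterS _ (ae_df_strict cH ZH)) => w [H01 Hinc].
    rewrite /= /h (Ddist_empirical_unif _ hn cH H01 Hinc).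
    suff -> : tnth [tuple H (Z i w) | i < n] = H \o (Z^~ w) by [].
    by apply/funext => i; rewrite tnth_mktuple.
rewrite (reduce _ _ _ X F cF iidX.2) (reduce _ _ _ Y G cG iidY.2).
apply: (iid_law_unif cF cG iidX iidY).
by rewrite -[_ @^-1` _]setTI; exact: mh.
Qed.
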